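(* The family $E_{3c}=E_{3c}(e_1,e_3,e_4,e_6)$ admits a shift operator for each of the shifts $e_1\to e_1\pm1$ and $e_i\to e_i\pm2$ ($i=3,4,6$), where in each case the other three of the free parameters $e_1,e_3,e_4,e_6$ are kept fixed.
   Context: Let $\partial=d/dx$ and $D=\mathbb{C}(x)[\partial]$. The operator $E_3(e)$: for $e=(e_1,\dots,e_7)$ with $e_1+\cdots+e_7=3$, put $$E_3(e)=x^2(x-1)^2\partial^3+x(x-1)(a_{21}x+a_{20})\partial^2+(a_{12}x^2+a_{11}x+a_{10})\partial+a_{01}x+A_{00}(e),$$ where $a_{21}=6-e_1-e_2-e_3-e_4$, $a_{20}=-3+e_1+e_2$, $a_{12}=(e_5+e_6+1)e_7+(e_6+1)(e_5+1)$, $a_{11}=-(e_5+e_6)e_7-e_1e_2+e_3e_4-e_5e_6+2e_1+2e_2-4$, $a_{10}=(e_1-1)(e_2-1)$, $a_{01}=e_5e_6e_7$, and $$\begin{aligned}54A_{00}(e)=&-4(e_1+e_2-e_3-e_4)^3-27e_5e_6e_7+9(e_1+e_2-e_3-e_4)(e_5e_6+e_5e_7+e_6e_7-2)\\&+9e_1e_2(e_1+e_2-1)+18(e_1+e_2-1)(e_3^2+e_3e_4+e_4^2)\\&-9e_3e_4(e_3+e_4-1)-18(e_3+e_4-1)(e_1^2+e_1e_2+e_2^2).\end{aligned}$$ $E_{3c}(e_1,e_3,e_4,e_6)$ is the specialization of $E_3(e)$ by $e_2=2e_1+e_3+e_4$, $e_5=1-e_1-e_3-e_4$ (and $e_7=3-(e_1+\cdots+e_6)$).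 Shift operators: let $E(p)$ be a family of third-order operators depending on parameters $p$, irreducible for generic $p$, and let $p\to p_+$ be a shift of the parameters by integers. A shift operator for this shift is a non-zero operator $P\in D$ of order lower than $3$, depending on $p$, sending the solution space of $E(p)$ to the solution space of $E(p_+)$; equivalently, there is $Q\in D$ with $E(p_+)\circ P=Q\circ E(p)$. The parameters are regarded as generic (indeterminates); the coefficients of $P$ are rational functions of $x$ and of $p$ (poles in $x$ are allowed; after normalization they may be taken polynomial in $p$ without common factor). *)

(* Defs.v *)
From HB Require Import structures.
From mathcomp Require Import all_boot all_order all_algebra.
From mathcomp Require Import complex mpoly reals ring.

Set Implicit Arguments.
Unset Strict Implicit.
Unset Printing Implicit Defensive.

Import GRing.Theory.
Local Open Scope ring_scope.
Local Open Scope quotient_scope.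

Local Notation "p %:F" := (@FracField.tofrac _ p).

Section RationalFunctions.
Variable K : fieldType.
Local Notation F := {fraction {poly K}}.

Definition ratX : F := ('X : {poly K})%:F.

Definition ratC (c : K) : F := (c%:P)%:F.

(* d/dx by the quotient rule on the chosen representative of f; the value does
   not depend on that choice, see [ratderivE]. *)
Definition ratderiv (f : F) : F :=
  let n := \n_(repr f) in let d := \d_(repr f) in
  (n^`() * d - n * d^`())%:F / (d ^+ 2)%:F.

Lemma frac_repr (f : F) : f = (\n_(repr f))%:F / (\d_(repr f))%:F.
Proof.
have d0 : (\d_(repr f))%:F != 0 :> F by rewrite tofrac_eq0 denom_ratioP.
apply: (mulIf d0); rewrite divfK //; unlock FracField.tofrac.
rewrite -{1}[f]reprK -[LHS]FracField.pi_mul; apply/eqP.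
rewrite FracField.equivf_def /FracField.mulf.
by rewrite !numden_Ratio ?mulr1 ?oner_eq0 ?denom_ratioP // mulrC.
Qed.

Lemma ratderivE (n d : {poly K}) :
  d != 0 -> ratderiv (n%:F / d%:F) = (n^`() * d - n * d^`())%:F / (d ^+ 2)%:F.
Proof.
move=> d0.
have neq0F (p : {poly K}) : p != 0 -> p%:F != 0 :> F by rewrite tofrac_eq0.
suff quot (a b : {poly K}) : b != 0 -> n%:F / d%:F = a%:F / b%:F :> F ->
    (a^`() * b - a * b^`())%:F / (b ^+ 2)%:F
    = (n^`() * d - n * d^`())%:F / (d ^+ 2)%:F :> F.
  by apply: quot; [exact: denom_ratioP | exact: frac_repr].
move=> b0 /eqP; rewrite eqr_div ?neq0F // -!tofracM tofrac_eq => /eqP nbad.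
apply/eqP; rewrite eqr_div ?neq0F ?expf_neq0 // -!tofracM tofrac_eq; apply/eqP.
have dnbad : n^`() * b + n * b^`() = a^`() * d + a * d^`().
  by rewrite -!derivM nbad.
have -> : (a^`() * b - a * b^`()) * d ^+ 2
          = (a^`() * d + a * d^`()) * b * d - (a * d) * (d * b^`() + b * d^`()).
  by ring.
by rewrite -dnbad -nbad; ring.
Qed.

Lemma ratderivD (f g : F) : ratderiv (f + g) = ratderiv f + ratderiv g.
Proof.
rewrite (frac_repr f) (frac_repr g).
move: (denom_ratioP (repr f)) (denom_ratioP (repr g)).
move: (\n_(repr f)) (\d_(repr f)) (\n_(repr g)) (\d_(repr g)) => a b c d b0 d0.
have neq0F (p : {poly K}) : p != 0 -> p%:F != 0 :> F by rewrite tofrac_eq0.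
rewrite addf_div ?neq0F // -!tofracM -tofracD !ratderivE ?mulf_neq0 //.
rewrite addf_div ?neq0F ?expf_neq0 // -!tofracM -tofracD.
apply/eqP; rewrite eqr_div ?neq0F ?mulf_neq0 ?expf_neq0 ?mulf_neq0 //.
by rewrite -!tofracM tofrac_eq derivD !derivM; apply/eqP; ring.
Qed.

Lemma ratderivM (f g : F) :
  ratderiv (f * g) = ratderiv f * g + f * ratderiv g.
Proof.
rewrite (frac_repr f) (frac_repr g).
move: (denom_ratioP (repr f)) (denom_ratioP (repr g)).
move: (\n_(repr f)) (\d_(repr f)) (\n_(repr g)) (\d_(repr g)) => a b c d b0 d0.
have neq0F (p : {poly K}) : p != 0 -> p%:F != 0 :> F by rewrite tofrac_eq0.
rewrite mulf_div -!tofracM !ratderivE ?mulf_neq0 // !mulf_div -!tofracM.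
rewrite addf_div ?neq0F ?mulf_neq0 ?expf_neq0 // -!tofracM -tofracD.
apply/eqP; rewrite eqr_div ?neq0F ?mulf_neq0 ?expf_neq0 ?mulf_neq0 //.
by rewrite -!tofracM tofrac_eq !derivM; apply/eqP; ring.
Qed.

Lemma ratderiv_poly (p : {poly K}) : ratderiv p%:F = (p^`())%:F.
Proof.
rewrite -[p%:F]divr1 -tofrac1 ratderivE ?oner_eq0 //.
by rewrite derivC mulr0 subr0 mulr1 expr1n tofrac1 divr1.
Qed.

Lemma ratderiv0 : ratderiv 0 = 0.
Proof. by rewrite -tofrac0 ratderiv_poly deriv0. Qed.

(* K(x)[d/dx]: the polynomial L stands for the operator \sum_i L`_i (d/dx)^i,
   with coefficients on the left, so its order is (size L).-1.  The ring product
   of {poly F} is not the product of operators; [dcomp] is. *)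
Local Notation diffop := {poly F}.

Definition dmulx (L : diffop) : diffop := 'X * L + map_poly ratderiv L.

Definition dcomp (A B : diffop) : diffop :=
  \sum_(i < size A) A`_i *: iter i dmulx B.

Definition dapply (L : diffop) (f : F) : F :=
  \sum_(i < size L) L`_i * iter i ratderiv f.

Lemma dapply_wide n (L : diffop) (f : F) :
  (size L <= n)%N -> dapply L f = \sum_(i < n) L`_i * iter i ratderiv f.
Proof.
move=> le_n; rewrite /dapply.
rewrite (big_ord_widen _ (fun i => L`_i * iter i ratderiv f) le_n).
rewrite big_mkcond /=; apply: eq_bigr => i _.
by case: ltnP => // /(nth_default 0) ->; rewrite mul0r.
Qed.

Lemma dapplyD (A B : diffop) (f : F) :
  dapply (A + B) f = dapply A f + dapply B f.
Proof.
pose n := maxn (size A) (size B).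
rewrite (@dapply_wide n (A + B)) ?size_polyD //.
rewrite (@dapply_wide n A) ?leq_maxl // (@dapply_wide n B) ?leq_maxr //.
by rewrite -big_split; apply: eq_bigr => i _; rewrite coefD mulrDl.
Qed.

Lemma dapplyZ (a : F) (A : diffop) (f : F) :
  dapply (a *: A) f = a * dapply A f.
Proof.
rewrite (@dapply_wide (size A)) ?size_scale_leq // /dapply mulr_sumr.
by apply: eq_bigr => i _; rewrite coefZ mulrA.
Qed.

Lemma dapply_dmulx (A : diffop) (f : F) :
  dapply (dmulx A) f = ratderiv (dapply A f).
Proof.
rewrite /dmulx dapplyD (@dapply_wide (size A).+1 ('X * A)); last first.
  by rewrite (leq_trans (size_polyMleq _ _)) // size_polyX.
rewrite (@dapply_wide (size A) (map_poly _ _)) ?size_poly //.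
rewrite big_ord_recl coefXM mul0r add0r -big_split /dapply.
rewrite (big_morph ratderiv ratderivD ratderiv0).
apply: eq_bigr => i _; rewrite coefXM /= ratderivM addrC.
by rewrite coef_map_id0 ?ratderiv0.
Qed.

Lemma dapply_dcomp (A B : diffop) (f : F) :
  dapply (dcomp A B) f = dapply A (dapply B f).
Proof.
rewrite /dcomp (big_morph (dapply^~ f) (fun A B => dapplyD A B f)
  (_ : dapply 0 f = 0)); last by rewrite /dapply size_poly0 big_ord0.
apply: eq_bigr => i _; rewrite dapplyZ; congr (_ * _).
by elim: (nat_of_ord i) => //= n IHn; rewrite dapply_dmulx IHn.
Qed.

(* P sends the solutions of E to solutions of E'. *)
Definition shift_operator (E E' P : diffop) : Prop :=
  [/\ P != 0, (size P <= 3)%N & exists Q : diffop, dcomp E' P = dcomp Q E].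

Definition admits_shift_operator (E E' : diffop) : Prop :=
  exists P : diffop, shift_operator E E' P.

(* The accessory parameter; the paper gives 54 times it. *)
Definition A00 (e1 e2 e3 e4 e5 e6 e7 : K) : K :=
  (- 4%:R * (e1 + e2 - e3 - e4) ^+ 3 - 27%:R * e5 * e6 * e7
   + 9%:R * (e1 + e2 - e3 - e4) * (e5 * e6 + e5 * e7 + e6 * e7 - 2%:R)
   + 9%:R * e1 * e2 * (e1 + e2 - 1)
   + 18%:R * (e1 + e2 - 1) * (e3 ^+ 2 + e3 * e4 + e4 ^+ 2)
   - 9%:R * e3 * e4 * (e3 + e4 - 1)
   - 18%:R * (e3 + e4 - 1) * (e1 ^+ 2 + e1 * e2 + e2 ^+ 2)) / 54%:R.

(* Meant for e1 + ... + e7 = 3. *)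
Definition E3 (e1 e2 e3 e4 e5 e6 e7 : K) : diffop :=
  let a21 := 6%:R - e1 - e2 - e3 - e4 in
  let a20 := - 3%:R + e1 + e2 in
  let a12 := (e5 + e6 + 1) * e7 + (e6 + 1) * (e5 + 1) in
  let a11 := - (e5 + e6) * e7 - e1 * e2 + e3 * e4 - e5 * e6
             + 2%:R * e1 + 2%:R * e2 - 4%:R in
  let a10 := (e1 - 1) * (e2 - 1) in
  let a01 := e5 * e6 * e7 in
  (ratX ^+ 2 * (ratX - 1) ^+ 2) *: 'X^3
  + (ratX * (ratX - 1) * (ratC a21 * ratX + ratC a20)) *: 'X^2
  + (ratC a12 * ratX ^+ 2 + ratC a11 * ratX + ratC a10) *: 'X
  + (ratC a01 * ratX + ratC (A00 e1 e2 e3 e4 e5 e6 e7))%:P.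

Definition E3c (e1 e3 e4 e6 : K) : diffop :=
  let e2 := 2%:R * e1 + e3 + e4 in
  let e5 := 1 - e1 - e3 - e4 in
  let e7 := 3%:R - (e1 + e2 + e3 + e4 + e5 + e6) in
  E3 e1 e2 e3 e4 e5 e6 e7.

End RationalFunctions.

(* The field of rational functions over the complex numbers R[i] in four
   indeterminates, numbered 0 to 3. *)
Definition paramField (R : realType) : fieldType := {fraction {mpoly R[i][4]}}.

Definition indet (R : realType) (k : nat) : paramField R :=
  ('X_(inord k) : {mpoly R[i][4]})%:F.

(* Main.v *)
From HB Require Import structures.
Require Import Defs.
From mathcomp Require Import all_boot all_order all_algebra.
From mathcomp Require Import complex mpoly reals ring.

(* At 0, 1 and infinity the operator E3 has the exponents (0, e1, e2),
   (0, e3, e4) and (e5, e6, e7).  Expanding a shift operator P and its companion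
   Q along x at 0, x - 1 at 1 and 1/x at infinity, the extreme coefficients are
   forced by how the exponents move; since 2 A00 = (e2 - 1) (e6 e7 - e3 e4) in
   the family E3c, the few remaining constants are rational in the parameters,
   and E' P = Q E is an identity between rational functions.  The shifts of e4
   follow from those of e3 by the symmetry e3 <-> e4, and e6 -> e6 - 2 is
   e7 -> e7 + 2, which the symmetry e6 <-> e7 turns into e6 -> e6 + 2. *)

Set Implicit Arguments.
Unset Strict Implicit.
Unset Printing Implicit Defensive.

Import GRing.Theory Num.Theory.
Local Open Scope ring_scope.

(** * Explicit intertwining identities over an abstract differential field *)

Section DifferentialField.
Variables (K F : fieldType) (C : {rmorphism K -> F}) (D : F -> F) (x : F).

(** The Leibniz rule, expanded. The list runs upward from the coefficient of order 0, the tuples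
    downward from the leading coefficient. *)
Definition order3_comp_order2 (g : F * F * F * F) (p : F * F * F) : seq F :=
  let: (g3, g2, g1, g0) := g in let: (p2, p1, p0) := p in
  [:: g3 * D (D (D p0)) + g2 * D (D p0) + g1 * D p0 + g0 * p0;
      g3 * (D (D (D p1)) + 3%:R * D (D p0)) + g2 * (D (D p1) + 2%:R * D p0)
        + g1 * (D p1 + p0) + g0 * p1;
      g3 * (D (D (D p2)) + 3%:R * D (D p1) + 3%:R * D p0)
        + g2 * (D (D p2) + 2%:R * D p1 + p0) + g1 * (D p2 + p1) + g0 * p2;
      g3 * (3%:R * D (D p2) + 3%:R * D p1 + p0) + g2 * (2%:R * D p2 + p1)
        + g1 * p2;
      g3 * (3%:R * D p2 + p1) + g2 * p2;
      g3 * p2].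

Definition order2_comp_order3 (b : F * F * F) (f : F * F * F * F) : seq F :=
  let: (b2, b1, b0) := b in let: (f3, f2, f1, f0) := f in
  [:: b2 * D (D f0) + b1 * D f0 + b0 * f0;
      b2 * (D (D f1) + 2%:R * D f0) + b1 * (D f1 + f0) + b0 * f1;
      b2 * (D (D f2) + 2%:R * D f1 + f0) + b1 * (D f2 + f1) + b0 * f2;
      b2 * (D (D f3) + 2%:R * D f2 + f1) + b1 * (D f3 + f2) + b0 * f3;
      b2 * (2%:R * D f3 + f2) + b1 * f3;
      b2 * f3].

(* The coefficients of [E3c] and of all shift operators lie in this span; [u] and
   [v] are the residues at 0 and 1. *)
Definition pfrac (a4 a3 a2 a1 a0 u v : K) : F :=
  C a4 * x ^+ 4 + C a3 * x ^+ 3 + C a2 * x ^+ 2 + C a1 * x + C a0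
  + C u / x + C v / (x - 1).

Local Notation quad c2 c1 c0 := (pfrac 0 0 c2 c1 c0 0 0).
(* [x (x - 1) (b1 x + b0)] *)
Local Notation fuchs1 b1 b0 := (pfrac 0 b1 (b0 - b1) (- b0) 0 0 0).
(* [x ^ 2 (x - 1) ^ 2] *)
Local Notation fuchs2 := (pfrac 1 (- 2%:R) 1 0 0 0 0).

(** [e7] takes this form because [e1 + e3 + e4 + e5 = 1] in the family; the last entry contains the
    factored accessory parameter. *)
Definition E3c_coef (e1 e3 e4 e6 : K) : F * F * F * F :=
  let e2 := 2%:R * e1 + e3 + e4 in
  let e5 := 1 - e1 - e3 - e4 in
  let e7 := 2%:R - e2 - e6 in
  (fuchs2,
   fuchs1 (6%:R - e1 - e2 - e3 - e4) (e1 + e2 - 3%:R),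
   quad ((e5 + e6 + 1) * e7 + (e6 + 1) * (e5 + 1))
     (- (e5 + e6) * e7 - e1 * e2 + e3 * e4 - e5 * e6 + 2%:R * e1 + 2%:R * e2 - 4%:R)
     ((e1 - 1) * (e2 - 1)),
   quad 0 (e5 * e6 * e7) ((e2 - 1) * (e6 * e7 - e3 * e4) / 2%:R)).

Hypotheses (DD : {morph D : f g / f + g})
  (DM : forall f g, D (f * g) = D f * g + f * D g)
  (DC : forall c, D (C c) = 0) (Dx : D x = 1).
Hypotheses (x_neq0 : x != 0) (y_neq0 : x - 1 != 0).

Lemma derivation1 : D 1 = 0.
Proof. by rewrite -(rmorph1 C) DC. Qed.

Lemma derivationN f : D (- f) = - D f.
Proof. by apply/eqP; rewrite -addr_eq0 -DD addNr -[in D _](rmorph0 C) DC. Qed.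

Lemma derivationZ c f : D (C c * f) = C c * D f.
Proof. by rewrite DM DC mul0r add0r. Qed.

Lemma derivationX f n : D (f ^+ n) = n%:R * f ^+ n.-1 * D f.
Proof.
case: n => [|n]; first by rewrite expr0 derivation1 !mul0r.
elim: n => [|n IHn]; first by rewrite expr1 mul1r expr0 mul1r.
by rewrite exprS DM IHn [n.+2%:R]mulrS /= exprS; ring.
Qed.

Lemma derivationV f : f != 0 -> D f^-1 = - D f / f ^+ 2.
Proof.
move=> f0; apply: (mulIf f0); have := DM f^-1 f.
rewrite mulVf // derivation1 => /eqP.
by rewrite eq_sym addr_eq0 => /eqP ->; field.
Qed.

Let DVx : D x^-1 = - x^-1 ^+ 2.
Proof. by rewrite derivationV // Dx; field. Qed.

Let DVy : D (x - 1)^-1 = - (x - 1)^-1 ^+ 2.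
Proof. by rewrite derivationV // DD derivationN derivation1 Dx; field. Qed.

Let derivationE := (DD, derivationN, derivationZ, derivationX, DVx, DVy, Dx, DC).

Lemma pfracD a4 a3 a2 a1 a0 u v : D (pfrac a4 a3 a2 a1 a0 u v) =
  C (4%:R * a4) * x ^+ 3 + C (3%:R * a3) * x ^+ 2 + C (2%:R * a2) * x
  + C a1 - C u * x^-1 ^+ 2 - C v * (x - 1)^-1 ^+ 2.
Proof. by rewrite !derivationE; field; rewrite x_neq0 y_neq0. Qed.

Lemma pfracDD a4 a3 a2 a1 a0 u v : D (D (pfrac a4 a3 a2 a1 a0 u v)) =
  C (12%:R * a4) * x ^+ 2 + C (6%:R * a3) * x + C (2%:R * a2)
  + C (2%:R * u) * x^-1 ^+ 3 + C (2%:R * v) * (x - 1)^-1 ^+ 3.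
Proof. by rewrite pfracD !derivationE; field; rewrite x_neq0 y_neq0. Qed.

Lemma pfracDDD a4 a3 a2 a1 a0 u v : D (D (D (pfrac a4 a3 a2 a1 a0 u v))) =
  C (24%:R * a4) * x + C (6%:R * a3)
  - C (6%:R * u) * x^-1 ^+ 4 - C (6%:R * v) * (x - 1)^-1 ^+ 4.
Proof. by rewrite pfracDD !derivationE; field; rewrite x_neq0 y_neq0. Qed.

Local Ltac compare_coefficients :=
  congr [:: _; _; _; _; _; _]; rewrite ?(pfracDDD, pfracDD, pfracD) /pfrac; field;
  (* The denominators met by [field] are built from values of [C]; gathered into a single value,
     they vanish only if its argument vanishes in [K]. *)
  rewrite -?(rmorph_nat C) -?(rmorphM C) -?(rmorphD C) ?fmorph_eq0 ?x_neq0 ?y_neq0.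

(** The shift moves [e2], [e5], [e7] by 2, -1, -2. As P raises degrees at infinity by 2, its
    indicial roots must be [e1], [e2] at 0 and [e5], [e6] at infinity. The accessory parameter is
    [(e2 - 1) * h]. *)
Lemma intertwine_e1_up (e1 e3 e4 e6 : K) : 2%:R != 0 :> K ->
  let e2 := 2%:R * e1 + e3 + e4 in
  let e5 := 1 - e1 - e3 - e4 in
  let e7 := 2%:R - e2 - e6 in
  let h := (e6 * e7 - e3 * e4) / 2%:R in
  order3_comp_order2 (E3c_coef (e1 + 1) e3 e4 e6)
    (fuchs2, fuchs1 (e5 + e6 + 1) (e1 + e2 - 1),
     quad (e5 * e6) (e2 * e6 - h) (e1 * e2))
  = order2_comp_order3
    (fuchs2, fuchs1 (e5 + e6 + 2%:R) (e1 + e2),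
     quad (e5 * (e6 + 1)) (e2 * e6 + e2 + e6 - h) (e1 * (e2 + 1)))
    (E3c_coef e1 e3 e4 e6).
Proof.
by move=> nz2 /=; compare_coefficients; rewrite ?nz2.
Qed.

(** P lowers degrees at 0 by 2, with indicial roots 0 and [e1]; the residue [- h] cancels the pole
    in the image of the solution of exponent 0. At infinity the roots are [e5] and [e7]. The double
    pole in Q lies outside [pfrac], but the coefficients of Q are never differentiated. *)
Lemma intertwine_e1_down (e1 e3 e4 e6 : K) : 2%:R != 0 :> K ->
  let e2 := 2%:R * e1 + e3 + e4 in
  let e5 := 1 - e1 - e3 - e4 in
  let e7 := 2%:R - e2 - e6 in
  let h := (e6 * e7 - e3 * e4) / 2%:R in
  order3_comp_order2 (E3c_coef (e1 - 1) e3 e4 e6)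
    (quad 1 (- 2%:R) 1,
     pfrac 0 0 0 (e5 + e7 + 1) (e1 - e5 - e7 - 2%:R) (1 - e1) 0,
     pfrac 0 0 0 0 (e5 * e7) (- h) 0)
  = order2_comp_order3
    (quad 1 (- 2%:R) 1,
     pfrac 0 0 0 (e5 + e7 + 2%:R) (e1 - e5 - e7 - 2%:R) (- e1) 0,
     pfrac 0 0 0 0 (e5 * (e7 + 1)) (e7 - h) 0 + C e1 / x ^+ 2)
    (E3c_coef e1 e3 e4 e6).
Proof.
by move=> nz2 /=; compare_coefficients; rewrite ?nz2.
Qed.

(** The indicial roots of P are [e2], [- b] at 0, [e3], [- a] at 1 and [e6], [c] at infinity. The
    first of each pair is forced; [a], [b], [c] delay the images of these solutions one step
    further, to the exponents [e2 + 2], [e3 + 2] and [e6]. *)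
Lemma intertwine_e3_up (e1 e3 e4 e6 : K) : 2%:R != 0 :> K ->
  let e2 := 2%:R * e1 + e3 + e4 in
  let e5 := 1 - e1 - e3 - e4 in
  let e7 := 2%:R - e2 - e6 in
  let d := 2%:R * e1 + 3%:R * e3 + 2%:R * e4 + e6 + 2%:R in
  let b := (e3 + e6) * (e3 + e4 + 1) / d in
  let c := e7 - (e3 - e6 + 2%:R) * (e3 + e4 + 1) / d in
  let a := (e3 + 1) * (2%:R * e1 + e3 + e6) / d in
  d != 0 ->
  order3_comp_order2 (E3c_coef e1 (e3 + 2%:R) e4 e6)
    (fuchs2, fuchs1 (e6 + c + 1) (e2 - b - 1),
     quad (e6 * c) (e2 * b - e3 * a - e6 * c) (- e2 * b))
  = order2_comp_order3
    (fuchs2, fuchs1 (e6 + c + 1) (e2 - b - 1),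
     quad ((e6 + 1) * (c - 1))
       ((e2 + 1) * (b + 1) - (e3 + 1) * (a + 1) - (e6 + 1) * (c - 1))
       (- (e2 + 1) * (b + 1)))
    (E3c_coef e1 e3 e4 e6).
Proof.
by move=> nz2 /= nzd; compare_coefficients; rewrite ?nz2 ?nzd.
Qed.

(** No exponent moves at 0 or 1, so only the roots [e5] and [e6] at infinity are forced. [m] and [n]
    provide the further cancellations there that restore [e5] and take [e6] to [e6 + 2]. *)
Lemma intertwine_e6_up (e1 e3 e4 e6 : K) : 2%:R != 0 :> K ->
  let e2 := 2%:R * e1 + e3 + e4 in
  let e5 := 1 - e1 - e3 - e4 in
  let m := (e3 - e6) * (e4 - e6) / (2%:R * (e1 + e6)) in
  let n := (e3 + e6) * (e4 + e6) / (2%:R * (e2 + 2%:R * e6)) in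
  e1 + e6 != 0 -> e2 + 2%:R * e6 != 0 ->
  order3_comp_order2 (E3c_coef e1 e3 e4 (e6 + 2%:R))
    (fuchs2, fuchs1 (e5 + e6 + 1) (e1 - m - 1),
     quad (e5 * e6) (e1 * m - e5 * e6) (m * n))
  = order2_comp_order3
    (fuchs2, fuchs1 (e5 + e6 + 5%:R) (e1 - m - 3%:R),
     quad ((e5 + 1) * (e6 + 3%:R))
       (2%:R * (e1 - m) + e1 * m - e5 * e6 - 2%:R * e5 - 4%:R)
       (m * n + m - e1 + 1))
    (E3c_coef e1 e3 e4 e6).
Proof.
by move=> nz2 /= nzm nzn; compare_coefficients; rewrite ?nz2 ?nzm ?nzn.
Qed.

(* [q2 x ^ 2 + q1 x + q0] is the polynomial [q] of apparent singularities, [qy]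
   its value at 1, and the coefficient of [d/dx] on the left is
   [q ((1 - e1) / x + (1 - e4) / (x - 1)) + (e7 - e3) q' / 2]. *)
Lemma intertwine_e3_down (e1 e3 e4 e6 : K) : 2%:R != 0 :> K ->
  let e2 := 2%:R * e1 + e3 + e4 in
  let e5 := 1 - e1 - e3 - e4 in
  let e7 := 2%:R - e2 - e6 in
  let h := (e6 * e7 - e3 * e4) / 2%:R in
  let q2 := (e3 - e6) * (e1 + e7) in
  let q1 := (e3 - e6) * (e3 + e6 - 2%:R) in
  let q0 := e5 * (e3 + e6 - 2%:R) in
  let g := e3 + 2%:R * e5 - e6 in
  let qy := (e3 - 1) * g in
  let cy := - g * ((e2 - 1) * h + e5 * e6 * e7) in
  order3_comp_order2 (E3c_coef e1 (e3 - 2%:R) e4 e6)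
    (quad q2 q1 q0,
     pfrac 0 0 0 (q2 * (2%:R - e1 - e4 + (e7 - e3)))
       (q1 * (1 - e1) + (q1 + q2) * (1 - e4) + (e7 - e3) * q1 / 2%:R)
       (q0 * (1 - e1)) (qy * (1 - e4)),
     pfrac 0 0 0 0 (q2 * e5 * e7) (- q0 * h) cy)
  = order2_comp_order3
    (quad q2 q1 q0,
     pfrac 0 0 0 (q2 * (4%:R - e1 - e4 + (e7 - e3)))
       (- q1 * (1 + e1) - (q1 + q2) * (1 + e4) + ((e7 - e3) / 2%:R + 3%:R) * q1)
       (- q0 * (1 + e1)) (- qy * (1 + e4)),
     pfrac 0 0 0 0 (q2 * (e5 * e7 + 2%:R - e1 - e4 + (e7 - e3)))
       (- q0 * (h + e4 - e7))
       (cy + g * (e4 * (e6 - 1) - e7 * (e3 - 1)))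
     + C (q0 * (1 + e1)) / x ^+ 2 + C (qy * (1 + e4)) / (x - 1) ^+ 2)
    (E3c_coef e1 e3 e4 e6).
Proof.
by move=> nz2 /=; compare_coefficients; rewrite ?nz2.
Qed.

End DifferentialField.

(** * Composition of operators given by coefficient lists *)

Section OperatorComposition.
Variable K : fieldType.
Local Notation F := {fraction {poly K}}.
Local Notation D := (@ratderiv K).

Definition diffop_of (s : seq F) : {poly F} := Poly s.
Arguments diffop_of : simpl never.

Lemma coef_diffop_of s i : (diffop_of s)`_i = s`_i.
Proof. exact: coef_Poly. Qed.

(** The Leibniz rule for d/dx on the left. As [0.-1] is 0, the multiplicity [i != 0] suppresses the
    shifted term in degree 0. *)
Lemma dmulx_diffop_of (s : seq F) :
  dmulx (diffop_of s) =
  diffop_of [seq s`_i.-1 *+ (i != 0%N) + D s`_i | i <- iota 0 (size s).+1].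
Proof.
apply/polyP=> i; rewrite coefD coefXM coef_map_id0 ?ratderiv0 // !coef_diffop_of.
case: (ltnP i (size s).+1) => [lt_i|ge_i].
  rewrite (nth_map 0%N) ?size_iota // nth_iota // add0n.
  by case: i lt_i => [|i] _ //=; rewrite mulr0n.
rewrite [RHS]nth_default ?size_map ?size_iota //.
rewrite !(nth_default _ (n := i)) ?(ltnW ge_i) // ratderiv0 addr0.
by case: i ge_i => [|i] //= ge_i; rewrite nth_default.
Qed.

Lemma dcomp_diffop_of (s : seq F) B :
  dcomp (diffop_of s) B = \sum_(i < size s) s`_i *: iter i (@dmulx K) B.
Proof.
rewrite /dcomp (big_ord_widen _ (fun i => (diffop_of s)`_i *: iter i _ B)
  (size_Poly s : (size (diffop_of s) <= _)%N)).
rewrite big_mkcond /=; apply: eq_bigr => i _; rewrite coef_diffop_of.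
by case: ltnP => // le_i; rewrite -coef_diffop_of nth_default // scale0r.
Qed.

Lemma dcomp_order3_order2 (g : F * F * F * F) (p : F * F * F) :
  dcomp (diffop_of [:: g.2; g.1.2; g.1.1.2; g.1.1.1]) (diffop_of [:: p.2; p.1.2; p.1.1])
  = diffop_of (order3_comp_order2 D g p).
Proof.
case: g p => [[[g3 g2] g1] g0] [[p2 p1] p0].
rewrite dcomp_diffop_of !big_ord_recr big_ord0 /= !dmulx_diffop_of /=.
apply/polyP=> i; rewrite !(coefD, coefZ, coef0, coef_diffop_of).
by case: i => [|[|[|[|[|[|i]]]]]] /=; rewrite ?ratderivD ?ratderiv0 ?nth_nil; ring.
Qed.

Lemma dcomp_order2_order3 (b : F * F * F) (f : F * F * F * F) :
  dcomp (diffop_of [:: b.2; b.1.2; b.1.1]) (diffop_of [:: f.2; f.1.2; f.1.1.2; f.1.1.1])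
  = diffop_of (order2_comp_order3 D b f).
Proof.
case: f b => [[[f3 f2] f1] f0] [[b2 b1] b0].
rewrite dcomp_diffop_of !big_ord_recr big_ord0 /= !dmulx_diffop_of /=.
apply/polyP=> i; rewrite !(coefD, coefZ, coef0, coef_diffop_of).
by case: i => [|[|[|[|[|[|i]]]]]] /=; rewrite ?ratderivD ?ratderiv0 ?nth_nil; ring.
Qed.

End OperatorComposition.

Arguments diffop_of : simpl never.
Arguments ratderiv : simpl never.

(** * From coefficient identities to shift operators over K(x) *)

Section ShiftOperators.
Variable K : fieldType.
Local Notation F := {fraction {poly K}}.
Local Notation x := (ratX K).

HB.instance Definition _ :=
  GRing.RMorphism.copy (@ratC K) (@FracField.tofrac _ \o @polyC K).

Local Notation C := (@ratC K : {rmorphism K -> F}).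
Local Notation D := (@ratderiv K).
Local Notation coefs := (E3c_coef C x).

Lemma ratX_neq0 : x != 0.
Proof. by rewrite tofrac_eq0 polyX_eq0. Qed.

Lemma ratXB1_neq0 : x - 1 != 0.
Proof. by rewrite -tofrac1 -tofracB tofrac_eq0 polyXsubC_eq0. Qed.

Lemma ratderivC c : D (C c) = 0.
Proof. by rewrite ratderiv_poly derivC tofrac0. Qed.

Lemma ratderivX : D x = 1.
Proof. by rewrite ratderiv_poly derivX tofrac1. Qed.

(** Each leading coefficient chosen for P is a polynomial whose coefficient of [x ^+ 2] is 1, or
    [q2] for the shift of [e3] by -2. *)
Lemma pfrac_neq0 a4 a3 a2 a1 a0 : a2 != 0 -> pfrac C x a4 a3 a2 a1 a0 0 0 != 0.
Proof.
move=> a2_neq0; pose p := Poly [:: a0; a1; a2; a3; a4].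
rewrite (_ : pfrac _ _ _ _ _ _ _ _ _ = FracField.tofrac p).
  rewrite tofrac_eq0; apply: contraNneq a2_neq0 => p0.
  by rewrite -[0](coef0 K 2) -p0 coef_Poly.
rewrite /p /= !cons_poly_def !(rmorphD, rmorphM) /= /pfrac /ratX /ratC !rmorph0.
by ring.
Qed.

Lemma A00_E3c (e1 e3 e4 e6 : K) : 54%:R != 0 :> K ->
  let e2 := 2%:R * e1 + e3 + e4 in
  let e5 := 1 - e1 - e3 - e4 in
  let e7 := 2%:R - e2 - e6 in
  A00 e1 e2 e3 e4 e5 e6 e7 = (e2 - 1) * (e6 * e7 - e3 * e4) / 2%:R.
Proof.
move=> nz54 /=; have nz2 : 2%:R != 0 :> K.
  by apply: contraNneq nz54 => eq0; rewrite (natrM K 2 27) eq0 mul0r.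
by rewrite /A00; field; rewrite nz54 nz2.
Qed.

Lemma E3cE (e1 e3 e4 e6 : K) : 54%:R != 0 :> K ->
  let f := coefs e1 e3 e4 e6 in
  E3c e1 e3 e4 e6 = diffop_of [:: f.2; f.1.2; f.1.1.2; f.1.1.1].
Proof.
move=> nz54 /=; rewrite /E3c.
have -> : 3%:R - (e1 + (2%:R * e1 + e3 + e4) + e3 + e4 + (1 - e1 - e3 - e4) + e6)
          = 2%:R - (2%:R * e1 + e3 + e4) - e6 by ring.
rewrite /E3 A00_E3c // /pfrac !rmorph0 !mul0r; apply/polyP=> i.
rewrite !(coefD, coefZ, coefXn, coefC, coefX, coef_diffop_of).
by case: i => [|[|[|[|i]]]] /=; rewrite ?nth_nil; ring.
Qed.

Lemma admits_shift_operatorI (e1 e3 e4 e6 e1' e3' e4' e6' : K) p b :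
    54%:R != 0 :> K ->
    order3_comp_order2 D (coefs e1' e3' e4' e6') p
    = order2_comp_order3 D b (coefs e1 e3 e4 e6) ->
    p.1.1 != 0 ->
  admits_shift_operator (E3c e1 e3 e4 e6) (E3c e1' e3' e4' e6').
Proof.
move=> nz54 eq_comp p2_neq0; rewrite !E3cE //.
exists (diffop_of [:: p.2; p.1.2; p.1.1]); split.
- apply: contraNneq p2_neq0 => p0.
  by apply/eqP; rewrite -[RHS](coef0 F 2) -p0 coef_diffop_of.
- exact: size_Poly.
- exists (diffop_of [:: b.2; b.1.2; b.1.1]).
  by rewrite dcomp_order3_order2 dcomp_order2_order3 eq_comp.
Qed.

End ShiftOperators.

(** * Single shifts, away from explicit exceptional parameters *)

Section ElementaryShifts.
Variable K : fieldType.
Local Notation F := {fraction {poly K}}.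
Local Notation C := (@ratC K : {rmorphism K -> F}).
Hypothesis nz54 : 54%:R != 0 :> K.

Let nz2 : 2%:R != 0 :> K.
Proof. by apply: contraNneq nz54 => eq0; rewrite (natrM K 2 27) eq0 mul0r. Qed.

Local Notation at_ratX intertwine :=
  (intertwine K F C (@ratderiv K) (ratX K)
     (@ratderivD K) (@ratderivM K) (@ratderivC K) (@ratderivX K)
     (@ratX_neq0 K) (@ratXB1_neq0 K)).

Lemma admits_shift_e1_up (e1 e3 e4 e6 : K) :
  admits_shift_operator (E3c e1 e3 e4 e6) (E3c (e1 + 1) e3 e4 e6).
Proof.
apply: (admits_shift_operatorI nz54 (at_ratX (@intertwine_e1_up) e1 e3 e4 e6 nz2)).
exact/pfrac_neq0/oner_neq0.
Qed.

Lemma admits_shift_e1_down (e1 e3 e4 e6 : K) :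
  admits_shift_operator (E3c e1 e3 e4 e6) (E3c (e1 - 1) e3 e4 e6).
Proof.
apply: (admits_shift_operatorI nz54 (at_ratX (@intertwine_e1_down) e1 e3 e4 e6 nz2)).
exact/pfrac_neq0/oner_neq0.
Qed.

Lemma admits_shift_e3_up (e1 e3 e4 e6 : K) :
    2%:R * e1 + 3%:R * e3 + 2%:R * e4 + e6 + 2%:R != 0 ->
  admits_shift_operator (E3c e1 e3 e4 e6) (E3c e1 (e3 + 2%:R) e4 e6).
Proof.
move=> nzd.
apply: (admits_shift_operatorI nz54 (at_ratX (@intertwine_e3_up) nz2 nzd)).
exact/pfrac_neq0/oner_neq0.
Qed.

(** The hypotheses concern the two factors of [q2], the second being [e1 + e7]. *)
Lemma admits_shift_e3_down (e1 e3 e4 e6 : K) :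
    e3 - e6 != 0 -> 2%:R - e1 - e3 - e4 - e6 != 0 ->
  admits_shift_operator (E3c e1 e3 e4 e6) (E3c e1 (e3 - 2%:R) e4 e6).
Proof.
move=> nz36 nz17.
apply: (admits_shift_operatorI nz54 (at_ratX (@intertwine_e3_down) e1 e3 e4 e6 nz2)).
apply/pfrac_neq0; rewrite mulf_neq0 //.
by apply: contraNneq nz17 => <-; apply/eqP; ring.
Qed.

Lemma admits_shift_e6_up (e1 e3 e4 e6 : K) :
    e1 + e6 != 0 -> 2%:R * e1 + e3 + e4 + 2%:R * e6 != 0 ->
  admits_shift_operator (E3c e1 e3 e4 e6) (E3c e1 e3 e4 (e6 + 2%:R)).
Proof.
move=> nzm nzn.
apply: (admits_shift_operatorI nz54 (at_ratX (@intertwine_e6_up) nz2 nzm nzn)).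
exact/pfrac_neq0/oner_neq0.
Qed.

End ElementaryShifts.

(** * Permuting the exponents at 1 and at infinity *)

Section Symmetries.
Variable K : fieldType.

Lemma E3_swap34 (e1 e2 e3 e4 e5 e6 e7 : K) :
  E3 e1 e2 e3 e4 e5 e6 e7 = E3 e1 e2 e4 e3 e5 e6 e7.
Proof.
rewrite /E3 (_ : A00 e1 e2 e4 e3 e5 e6 e7 = A00 e1 e2 e3 e4 e5 e6 e7).
  congr (_ + (_ * (ratC _ * _ + _)) *: _ + (_ + ratC _ * _ + _) *: _ + _); ring.
by rewrite /A00; congr (_ / _); ring.
Qed.

Lemma E3_swap67 (e1 e2 e3 e4 e5 e6 e7 : K) :
  E3 e1 e2 e3 e4 e5 e6 e7 = E3 e1 e2 e3 e4 e5 e7 e6.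
Proof.
rewrite /E3 (_ : A00 e1 e2 e3 e4 e5 e7 e6 = A00 e1 e2 e3 e4 e5 e6 e7).
  congr (_ + _ + (ratC _ * _ + ratC _ * _ + _) *: _ + (ratC _ * _ + _)%:P); ring.
by rewrite /A00; congr (_ / _); ring.
Qed.

Lemma E3c_swap34 (e1 e3 e4 e6 : K) : E3c e1 e3 e4 e6 = E3c e1 e4 e3 e6.
Proof.
have congE e2 e2' e5 e5' e7 e7' : e2 = e2' -> e5 = e5' -> e7 = e7' ->
  E3 e1 e2 e3 e4 e5 e6 e7 = E3 e1 e2' e3 e4 e5' e6 e7' by move=> -> -> ->.
by rewrite [RHS]E3_swap34; apply: congE; ring.
Qed.

(** The new last parameter is [e7]; the seventh exponent computed from it is [e6] again, while [e2]
    and [e5] do not involve [e6]. *)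
Lemma E3c_swap67 (e1 e3 e4 e6 : K) :
  E3c e1 e3 e4 e6 = E3c e1 e3 e4 (2%:R - 2%:R * e1 - e3 - e4 - e6).
Proof.
have congE e2 e5 f6 f6' e7 e7' : f6 = f6' -> e7 = e7' ->
  E3 e1 e2 e3 e4 e5 f6 e7 = E3 e1 e2 e3 e4 e5 f6' e7' by move=> -> ->.
by rewrite [RHS]E3_swap67; apply: congE; ring.
Qed.

End Symmetries.

(** Genericity enters only through integral linear forms: all denominators and factors of leading
    coefficients are of this kind, the constant 54 included. *)
Lemma admits_shifts (K : fieldType) (e1 e3 e4 e6 : K) :
    (forall c0 c1 c3 c4 c6 : int, c0 + c1 + c3 + c4 + c6 * 2 != 0 ->
      c0%:~R + c1%:~R * e1 + c3%:~R * e3 + c4%:~R * e4 + c6%:~R * e6 != 0) ->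
  (admits_shift_operator (E3c e1 e3 e4 e6) (E3c (e1 + 1) e3 e4 e6) /\
   admits_shift_operator (E3c e1 e3 e4 e6) (E3c (e1 - 1) e3 e4 e6)) /\
  (admits_shift_operator (E3c e1 e3 e4 e6) (E3c e1 (e3 + 2%:R) e4 e6) /\
   admits_shift_operator (E3c e1 e3 e4 e6) (E3c e1 (e3 - 2%:R) e4 e6)) /\
  (admits_shift_operator (E3c e1 e3 e4 e6) (E3c e1 e3 (e4 + 2%:R) e6) /\
   admits_shift_operator (E3c e1 e3 e4 e6) (E3c e1 e3 (e4 - 2%:R) e6)) /\
  (admits_shift_operator (E3c e1 e3 e4 e6) (E3c e1 e3 e4 (e6 + 2%:R)) /\
   admits_shift_operator (E3c e1 e3 e4 e6) (E3c e1 e3 e4 (e6 - 2%:R))).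
Proof.
move=> nzform.
have nz c0 c1 c3 c4 c6 z :
    z = c0%:~R + c1%:~R * e1 + c3%:~R * e3 + c4%:~R * e4 + c6%:~R * e6 ->
    c0 + c1 + c3 + c4 + c6 * 2 != 0 -> z != 0.
  by move=> -> /nzform.
have nz54 : 54%:R != 0 :> K by apply: (nz 54 0 0 0 0) => //; ring.
split; [split|split; [split|split; split]].
- exact: admits_shift_e1_up.
- exact: admits_shift_e1_down.
- apply: admits_shift_e3_up => //.
  by apply: (nz 2 2 3 2 1) => //; ring.
- apply: admits_shift_e3_down => //.
    by apply: (nz 0 0 1 0 (-1)) => //; ring.
  by apply: (nz 2 (-1) (-1) (-1) (-1)) => //; ring.
- rewrite [E3c e1 e3 e4 e6]E3c_swap34 [E3c e1 e3 _ e6]E3c_swap34.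
  apply: admits_shift_e3_up => //.
  by apply: (nz 2 2 2 3 1) => //; ring.
- rewrite [E3c e1 e3 e4 e6]E3c_swap34 [E3c e1 e3 _ e6]E3c_swap34.
  apply: admits_shift_e3_down => //.
    by apply: (nz 0 0 0 1 (-1)) => //; ring.
  by apply: (nz 2 (-1) (-1) (-1) (-1)) => //; ring.
- apply: admits_shift_e6_up => //.
    by apply: (nz 0 1 0 0 1) => //; ring.
  by apply: (nz 0 2 1 1 2) => //; ring.
- rewrite [E3c e1 e3 e4 e6]E3c_swap67 [E3c e1 e3 e4 (e6 - _)]E3c_swap67.
  rewrite (_ : _ - (e6 - _) = 2%:R - 2%:R * e1 - e3 - e4 - e6 + 2%:R); last by ring.
  apply: admits_shift_e6_up => //.
    (* This form and the next are [e1 + e7] and [e2 + 2 * e7], as [e7] now stands in the place of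
       [e6]. *)
    by apply: (nz 2 (-1) (-1) (-1) (-1)) => //; ring.
  by apply: (nz 4 (-2) (-1) (-1) (-2)) => //; ring.
Qed.

(* Evaluation at (1, 1, 1, 2), a point where none of the linear forms met in
   [admits_shifts] vanishes. *)
Lemma linear_form_neq0 (R : realType) (c0 c1 c3 c4 c6 : int) :
    c0 + c1 + c3 + c4 + c6 * 2 != 0 ->
  c0%:~R + c1%:~R * indet R 0 + c3%:~R * indet R 1 + c4%:~R * indet R 2
    + c6%:~R * indet R 3 != 0 :> paramField R.
Proof.
move=> nz; rewrite /indet -!(rmorph_int (@FracField.tofrac _)) -!rmorphM -!rmorphD.
rewrite /= tofrac_eq0; apply: contraNneq nz.
move/(congr1 (meval (fun i : 'I_4 => if i == 3 :> nat then 2%:R else 1))).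
rewrite !(mevalD, mevalM, mevalXU) meval0 !rmorph_int !inordK //= !mulr1 => /eqP.
by rewrite (_ : 2%:R = 2%:~R) // -intrM -!intrD intr_eq0.
Qed.

Theorem theorem5p8 (R : realType) :
  let e1 : paramField R := indet R 0 in
  let e3 : paramField R := indet R 1 in
  let e4 : paramField R := indet R 2 in
  let e6 : paramField R := indet R 3 in
  (admits_shift_operator (E3c e1 e3 e4 e6) (E3c (e1 + 1) e3 e4 e6) /\
   admits_shift_operator (E3c e1 e3 e4 e6) (E3c (e1 - 1) e3 e4 e6)) /\
  (admits_shift_operator (E3c e1 e3 e4 e6) (E3c e1 (e3 + 2%:R) e4 e6) /\
   admits_shift_operator (E3c e1 e3 e4 e6) (E3c e1 (e3 - 2%:R) e4 e6)) /\
  (admits_shift_operator (E3c e1 e3 e4 e6) (E3c e1 e3 (e4 + 2%:R) e6) /\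
   admits_shift_operator (E3c e1 e3 e4 e6) (E3c e1 e3 (e4 - 2%:R) e6)) /\
  (admits_shift_operator (E3c e1 e3 e4 e6) (E3c e1 e3 e4 (e6 + 2%:R)) /\
   admits_shift_operator (E3c e1 e3 e4 e6) (E3c e1 e3 e4 (e6 - 2%:R))).
Proof. by apply: admits_shifts; apply: linear_form_neq0. Qed.
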